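(* Let $R$ be a commutative ring with unity, $t$ a positive integer and $a\in R$. The functor $a^{t}\Gamma_{a}:R\text{-Mod}\to R\text{-Mod}$, $M\mapsto a^{t}\Gamma_{a}(M)$, is a radical.
   Context: $R$-Mod is the category of $R$-modules. For an $R$-module $M$, $\Gamma_{a}(M):=\{m\in M\mid a^{k}m=0\text{ for some }k\in\mathbb{Z}^{+}\}$ and $a^{t}\Gamma_{a}(M):=\{a^{t}m\mid m\in\Gamma_{a}(M)\}$, a submodule of $M$. A functor $\gamma:R\text{-Mod}\to R\text{-Mod}$ assigning to each module $M$ a submodule $\gamma(M)\leq M$ is a preradical if for every $R$-homomorphism $f:M\to N$, $f(\gamma(M))\subseteq\gamma(N)$. A preradical $\gamma$ is a radical if $\gamma(M/\gamma(M))=0$ for all $R$-modules $M$. *)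

(* Defs.v *)
(* Submodules are boolean predicates; membership defined by an existential is
   made boolean classically, with `[< _ >] from boolp. *)
From HB Require Import structures.
From mathcomp Require Import all_boot all_order all_algebra.
From mathcomp Require Import boolp.

Set Implicit Arguments.
Unset Strict Implicit.
Unset Printing Implicit Defensive.

Import GRing.Theory.
Local Open Scope ring_scope.
Local Open Scope quotient_scope.

Section QuotientModule.
Variables (R : pzRingType) (M : lmodType R) (N : submodClosed M).

Lemma submod_oppr_closed : oppr_closed (N : {pred M}).
Proof. by move=> x Nx; rewrite -scaleN1r rpredZ. Qed.

(* MathComp's submodClosed does not inherit from zmodClosed, which is what its
   quotient construction expects. *)
Definition submod_zmodClosed : zmodClosed M :=
  HB.pack (GRing.SubmodClosed.sort N)
    (GRing.isOppClosed.Build M N submod_oppr_closed).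

Definition quot_mod : Type := Quotient.quot submod_zmodClosed.

HB.instance Definition _ := ZmodQuotient.on quot_mod.

Definition quot_mod_pi (x : M) : quot_mod := \pi x.

Lemma quot_modW (P : quot_mod -> Prop) :
  (forall x, P (quot_mod_pi x)) -> forall q, P q.
Proof. by move=> Ppi q; rewrite -[q]reprK; apply: Ppi. Qed.

Lemma quot_mod_eq x y : (quot_mod_pi x == quot_mod_pi y) = (x - y \in N).
Proof. by rewrite -Quotient.idealrBE. Qed.

Fact quot_mod_pi_is_zmod_morphism : zmod_morphism quot_mod_pi.
Proof. exact: pi_is_zmod_morphism. Qed.

HB.instance Definition _ := GRing.isZmodMorphism.Build M quot_mod quot_mod_pi
  quot_mod_pi_is_zmod_morphism.

Definition quot_mod_scale (a : R) (q : quot_mod) : quot_mod :=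
  quot_mod_pi (a *: repr q).

Lemma quot_mod_scale_pi a x :
  quot_mod_scale a (quot_mod_pi x) = quot_mod_pi (a *: x).
Proof.
apply/eqP; rewrite quot_mod_eq -scalerBr rpredZ // -quot_mod_eq.
by rewrite /quot_mod_pi reprK.
Qed.

Fact quot_mod_scalerA a b q :
  quot_mod_scale a (quot_mod_scale b q) = quot_mod_scale (a * b) q.
Proof. by elim/quot_modW: q => x; rewrite !quot_mod_scale_pi scalerA. Qed.

Fact quot_mod_scale1r : left_id 1 quot_mod_scale.
Proof. by elim/quot_modW=> x; rewrite quot_mod_scale_pi scale1r. Qed.

Fact quot_mod_scalerDr : right_distributive quot_mod_scale +%R.
Proof.
move=> a; elim/quot_modW=> x; elim/quot_modW=> y.
by rewrite -raddfD !quot_mod_scale_pi scalerDr raddfD.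
Qed.

Fact quot_mod_scalerDl q : {morph quot_mod_scale^~ q : a b / a + b}.
Proof.
by elim/quot_modW: q => x a b; rewrite !quot_mod_scale_pi scalerDl raddfD.
Qed.

HB.instance Definition _ := GRing.Zmodule_isLmodule.Build R quot_mod
  quot_mod_scalerA quot_mod_scale1r quot_mod_scalerDr quot_mod_scalerDl.

Fact quot_mod_pi_is_scalable : scalable quot_mod_pi.
Proof. by move=> a x; rewrite -quot_mod_scale_pi. Qed.

HB.instance Definition _ := GRing.isScalable.Build R M quot_mod *:%R quot_mod_pi
  quot_mod_pi_is_scalable.

Lemma quot_mod_pi_eq0 x : (quot_mod_pi x == 0) = (x \in N).
Proof. by rewrite -(raddf0 quot_mod_pi) quot_mod_eq subr0. Qed.

End QuotientModule.

Section Radical.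
Variables (R : pzRingType) (gamma : forall M : lmodType R, submodClosed M).

(* gamma acts on a morphism f by restriction, so that functoriality amounts to
   the inclusion f(gamma M) <= gamma N. *)
Definition preradical : Prop :=
  forall (M N : lmodType R) (f : {linear M -> N}),
    {homo f : x / x \in gamma M >-> x \in gamma N}.

Definition radical : Prop :=
  preradical /\
  forall M : lmodType R, gamma (quot_mod (gamma M)) =i pred1 0.

End Radical.

Section Gamma.
Variables (R : comPzRingType) (a : R) (t : nat) (M : lmodType R).

Definition Gamma : {pred M} :=
  [pred m | `[< exists2 k, (0 < k)%N & a ^+ k *: m = 0 >]].

Definition aGamma_pred : {pred M} :=
  [pred x | `[< exists2 m, m \in Gamma & x = a ^+ t *: m >]].

Fact Gamma_submod_closed : submod_closed Gamma.
Proof.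
split; first by apply/asboolP; exists 1%N; rewrite ?scaler0.
move=> c u v /asboolP[k k_gt0 ku0] /asboolP[l l_gt0 lv0]; apply/asboolP.
exists (k + l)%N; first by rewrite addn_gt0 k_gt0.
rewrite scalerDr !scalerA mulrC {1}addnC !exprD mulrA -!scalerA lv0 ku0.
by rewrite !scaler0 addr0.
Qed.

HB.instance Definition _ :=
  GRing.isSubmodClosed.Build R M Gamma Gamma_submod_closed.

Fact aGamma_submod_closed : submod_closed aGamma_pred.
Proof.
split; first by apply/asboolP; exists 0; rewrite ?scaler0 // rpred0.
move=> c _ _ /asboolP[m Gm ->] /asboolP[n Gn ->]; apply/asboolP.
exists (c *: m + n); first by rewrite rpredD // rpredZ.
by rewrite scalerDr !scalerA mulrC.
Qed.

HB.instance Definition _ :=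
  GRing.isSubmodClosed.Build R M aGamma_pred aGamma_submod_closed.

Definition aGamma : submodClosed M := aGamma_pred.

End Gamma.

(* Main.v *)
Require Import Defs.
From mathcomp Require Import all_boot all_order all_algebra.
From mathcomp Require Import boolp.

Import GRing.Theory.
Local Open Scope ring_scope.

(** Linear maps preserve both [a]-torsion and multiples of [a ^+ t], hence
    [a ^+ t *: Gamma] is a preradical. For the radical property, take
    [a ^+ t *: q] with [q] an [a]-torsion class modulo [a ^+ t *: Gamma M], and
    lift [q] to [m] in [M]. Some power of [a] sends [m] into
    [a ^+ t *: Gamma M], whose elements are themselves [a]-torsion, so [m]
    is [a]-torsion ([Gamma_saturated]). Therefore [a ^+ t *: m] already lies
    in [a ^+ t *: Gamma M], and its class [a ^+ t *: q] vanishes. *)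

Lemma Gamma_linear (R : comPzRingType) (a : R) (M N : lmodType R)
    (f : {linear M -> N}) :
  {homo f : m / m \in Gamma a (M := M) >-> m \in Gamma a (M := N)}.
Proof.
move=> m /asboolP[k k_gt0 km0]; apply/asboolP; exists k => //.
by rewrite -linearZ km0 linear0.
Qed.

Lemma aGamma_sub_Gamma (R : comPzRingType) (a : R) (t : nat) (M : lmodType R) :
  {subset aGamma a t M <= Gamma a (M := M)}.
Proof. by move=> _ /asboolP[m Gm ->]; rewrite rpredZ. Qed.

(** This is what lifts torsion along [M -> M / N] for any submodule [N] of
    [Gamma M]: a class killed by [a ^+ k] has representatives [m] with
    [a ^+ k *: m] in [N]. *)
Lemma Gamma_saturated (R : comPzRingType) (a : R) (M : lmodType R) (k : nat)
    (m : M) :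
  a ^+ k *: m \in Gamma a (M := M) -> m \in Gamma a (M := M).
Proof.
move=> /asboolP[l l_gt0 lkm0]; apply/asboolP.
exists (l + k)%N; first by rewrite addn_gt0 l_gt0.
by rewrite exprD -scalerA.
Qed.

Theorem proposition4p1 (R : comPzRingType) (t : nat) (a : R) (ht : (0 < t)%N) :
  radical (fun M : lmodType R => aGamma a t M).
Proof.
split=> [M N f _ /asboolP[m Gm ->] | M q].
  rewrite linearZ; apply/asboolP; exists (f m) => //.
  exact: Gamma_linear.
rewrite [RHS]inE; apply/idP/eqP => [/asboolP[q' + ->]|->]; last exact: rpred0.
elim/quot_modW: q' => m /asboolP[k _ /eqP].
rewrite -!linearZ quot_mod_pi_eq0 => /aGamma_sub_Gamma/Gamma_saturated Gm.
by apply/eqP; rewrite quot_mod_pi_eq0; apply/asboolP; exists m.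
Qed.
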